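(* Let $\mathcal{A}$ be a Banach algebra, let $\sigma:\mathcal{A}\to\mathcal{A}$ be a linear mapping, and let $\{\mathcal{A},\alpha\}$ be a $\sigma$-dynamics. Then $d(a)=\lim_{t\to 0}t^{-1}(\alpha_t(a)-a)$ is an everywhere defined $\sigma$-derivation; that is, the limit exists for every $a\in\mathcal{A}$ and $d:\mathcal{A}\to\mathcal{A}$ is a $\sigma$-derivation.
   Context: $\iota$ denotes the identity operator on $\mathcal{A}$. A linear mapping $d:\mathcal{A}\to\mathcal{A}$ is a $\sigma$-derivation if $d(ab)=d(a)\sigma(b)+\sigma(a)d(b)$ for all $a,b\in\mathcal{A}$. A linear mapping $\alpha:\mathcal{A}\to\mathcal{A}$ is a $\sigma$-endomorphism if $(\alpha+\sigma-\iota)(ab)-(\alpha+\sigma-\iota)(a)(\alpha+\sigma-\iota)(b)=\sigma(ab)-\sigma(a)\sigma(b)$ for all $a,b\in\mathcal{A}$. A $\sigma$-dynamics $\{\mathcal{A},\alpha\}$ is a family $\{\alpha_t\}_{t\in\mathbb{R}}$ of bounded $\sigma$-endomorphisms of $\mathcal{A}$ with $\alpha_t\alpha_s=\alpha_{t+s}$ for all $t,s\in\mathbb{R}$, $\alpha_0=\iota$, which is uniformly continuous: $\|\alpha_t-\iota\|\to0$ as $t\to0$. *)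

(* Defs.v *)
From HB Require Import structures.
From mathcomp Require Import all_boot all_order all_algebra.
From mathcomp Require Import complex.
From mathcomp Require Import all_classical all_reals all_analysis.

Set Implicit Arguments.
Unset Strict Implicit.
Unset Printing Implicit Defensive.

Import Order.TTheory GRing.Theory Num.Theory.
Import numFieldNormedType.Exports.

Local Open Scope classical_set_scope.
Local Open Scope ring_scope.
Local Open Scope complex_scope.

(* A Banach algebra may be real or complex; [scalars R k] is the scalar field. *)
Variant scalar_kind := RealScalars | ComplexScalars.

Definition scalars (R : realType) (k : scalar_kind) : numFieldType :=
  match k with
  | RealScalars => R
  | ComplexScalars => R[i]
  end.

Definition of_real (R : realType) (k : scalar_kind) : R -> scalars R k :=
  match k with
  | RealScalars => fun x => x
  | ComplexScalars => fun x => x%:C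
  end.

(* Norms of a [normedModType (scalars R k)] take values in [scalars R k]: over
   the complex numbers these are nonnegative reals embedded in [R[i]], and
   [to_real] reads them back in [R]. *)
Definition to_real (R : realType) (k : scalar_kind) : scalars R k -> R :=
  match k with
  | RealScalars => fun x => x
  | ComplexScalars => fun z => complex.Re z
  end.

(* The multiplication is a new operation because MathComp's algebra structures
   require a unit, which a Banach algebra need not have. *)
HB.mixin Record CompleteNormedModule_isBanachAlgebra (K : numFieldType) V
    of CompleteNormedModule K V := {
  bmul : V -> V -> V;
  bmulA : associative bmul;
  bmul_linear_l : forall b, linear (fun a => bmul a b);
  bmul_linear_r : forall a, linear (fun b => bmul a b);
  ler_norm_bmul : forall a b, `|bmul a b| <= `|a| * `|b|
}.

#[short(type="banachAlgType")]
HB.structure Definition BanachAlgebra (K : numFieldType) :=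
  {V of CompleteNormedModule K V & CompleteNormedModule_isBanachAlgebra K V}.

Notation "a ⋅ b" := (bmul a b) (at level 40, left associativity) : ring_scope.

Definition sigma_derivation (K : numFieldType) (A : banachAlgType K)
    (sigma d : A -> A) : Prop :=
  linear d /\ forall a b, d (a ⋅ b) = d a ⋅ sigma b + sigma a ⋅ d b.

Definition sigma_endomorphism (K : numFieldType) (A : banachAlgType K)
    (sigma alpha : A -> A) : Prop :=
  let beta a := alpha a + sigma a - a in
  linear alpha /\
  forall a b, beta (a ⋅ b) - beta a ⋅ beta b = sigma (a ⋅ b) - sigma a ⋅ sigma b.

Definition bounded_operator (R : realType) (k : scalar_kind)
    (A : normedModType (scalars R k)) (T : A -> A) : Prop :=
  exists M : R, forall a, `|T a| <= of_real k M * `|a|.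

(* [sup] of an unbounded set is 0, so [operator_norm T] is meaningful only
   when [T] is bounded. *)
Definition operator_norm (R : realType) (k : scalar_kind)
    (A : normedModType (scalars R k)) (T : A -> A) : R :=
  sup [set to_real `|T a| | a in [set a : A | `|a| <= 1]].

Definition sigma_dynamics (R : realType) (k : scalar_kind)
    (A : banachAlgType (scalars R k)) (sigma : A -> A) (alpha : R -> A -> A) :
    Prop :=
  [/\ forall t, sigma_endomorphism sigma (alpha t) /\ bounded_operator (alpha t),
      forall t s, alpha t \o alpha s = alpha (t + s),
      alpha 0 = id
    & operator_norm (fun a => alpha t a - a) @[t --> (0 : R)^'] --> (0 : R)].

(* Main.v *)
Require Import Defs.
From HB Require Import structures.
From mathcomp Require Import all_boot all_order all_algebra.
From mathcomp Require Import complex ring lra.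
From mathcomp Require Import all_classical all_reals all_analysis.

Import Order.TTheory GRing.Theory Num.Theory.
Import numFieldNormedType.Exports.

Local Open Scope classical_set_scope.
Local Open Scope ring_scope.

(* Write q_t = (alpha_t - 1)/t. Uniform continuity at 0 alone makes q_t
   converge: since alpha_{nt} - 1 = (sum_{j<n} alpha_{jt}) (alpha_t - 1), the
   vector q_t a is within e |q_t a| of q_{nt} a whenever alpha_s is e-close to
   the identity for |s| <= nt. Taking n = floor(tau/t), this makes q_t a first
   bounded as t -> 0+, then within O(e) of the fixed vector q_tau a, hence
   Cauchy; negative times are reached by q_{-t} = alpha_{-t} q_t. This replaces
   the usual argument through the Banach-valued integral of alpha. With
   D = alpha_t - 1, the sigma-endomorphism identity reads
   D(ab) = D(a) D(b) + D(a) sigma(b) + sigma(a) D(b); dividing by t and letting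
   t -> 0 yields the Leibniz rule, although sigma may be discontinuous. *)

(** * Real numbers inside the real or complex scalars *)

Section scalars.
Context {R : realType} {k : scalar_kind}.
Implicit Types (x y : R) (z : scalars R k).

Lemma of_real_is_zmod_morphism : zmod_morphism (@of_real R k).
Proof. by case: k => // x y; rewrite /= rmorphB/=. Qed.

Lemma of_real_is_monoid_morphism : monoid_morphism (@of_real R k).
Proof. by case: k; split=> // x y; rewrite /= rmorphM/=. Qed.

HB.instance Definition _ := GRing.isZmodMorphism.Build _ _ (@of_real R k)
  of_real_is_zmod_morphism.
HB.instance Definition _ := GRing.isMonoidMorphism.Build _ _ (@of_real R k)
  of_real_is_monoid_morphism.

Lemma ler_of_real x y : (of_real k x <= of_real k y) = (x <= y).
Proof. by case: k => //=; rewrite lecR. Qed.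

Lemma ltr_of_real x y : (of_real k x < of_real k y) = (x < y).
Proof. by case: k => //=; rewrite ltcR. Qed.

Lemma normr_of_real x : `|of_real k x| = of_real k `|x|.
Proof. by case: k => //=; rewrite normc_def /= expr0n /= addr0 sqrtr_sqr. Qed.

Lemma of_realK x : to_real (of_real k x) = x.
Proof. by case: k. Qed.

Lemma to_realK z : 0 <= z -> of_real k (to_real z) = z.
Proof.
case: k z => //= -[x y]; rewrite lecE /= => /andP[/eqP y0 _].
by rewrite y0.
Qed.

End scalars.

(** * Norms, convergence and operator bounds with values in [R] *)

Section real_norm.
Context {R : realType} {k : scalar_kind} {V : normedModType (scalars R k)}.
Implicit Types (u v : V) (x : R).

Definition real_norm v : R := to_real `|v|.

Lemma of_real_norm v : of_real k (real_norm v) = `|v|.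
Proof. exact: to_realK. Qed.

Lemma real_norm_ge0 v : 0 <= real_norm v.
Proof. by rewrite -(ler_of_real (k := k)) of_real_norm rmorph0. Qed.

Lemma real_norm0 : real_norm 0 = 0.
Proof. by rewrite /real_norm normr0 -(rmorph0 (@of_real R k)) of_realK. Qed.

Lemma real_norm0_eq0 v : real_norm v = 0 -> v = 0.
Proof. by move=> v0; apply/normr0_eq0; rewrite -of_real_norm v0 rmorph0. Qed.

Lemma ler_real_normD u v : real_norm (u + v) <= real_norm u + real_norm v.
Proof.
by rewrite -(ler_of_real (k := k)) rmorphD/= !of_real_norm ler_normD.
Qed.

Lemma real_normN v : real_norm (- v) = real_norm v.
Proof. by rewrite /real_norm normrN. Qed.

Lemma real_normZ x v : real_norm (of_real k x *: v) = `|x| * real_norm v.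
Proof.
rewrite -[RHS](of_realK (k := k)) rmorphM/= of_real_norm -normr_of_real.
by rewrite -normrZ.
Qed.

Lemma cvg_real_norm_dist {T : Type} {F : set_system T} {FF : Filter F}
    (f : T -> V) l :
  (forall e : R, 0 < e -> \forall x \near F, real_norm (f x - l) <= e) ->
  f x @[x --> F] --> l.
Proof.
move=> Fl; apply/subr_cvg0/cvgr0Pnorm_le => e e0.
have e_real : of_real k (to_real e) = e by apply/to_realK/ltW.
have /Fl : 0 < to_real e.
  by rewrite -(ltr_of_real (k := k)) e_real rmorph0.
by apply: filterS => x; rewrite -(ler_of_real (k := k)) of_real_norm e_real.
Qed.

End real_norm.

(** The centre [l] may depend on [e], so a Cauchy estimate needs no comparison of two moving points;
    below, [l] is a difference quotient at a fixed time. *)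
Lemma cvg_real_norm_cauchy {R : realType} {k : scalar_kind}
    {V : completeNormedModType (scalars R k)}
    {T : Type} {F : set_system T} {FF : ProperFilter F} (f : T -> V) :
  (forall e : R, 0 < e ->
    exists l, \forall x \near F, real_norm (l - f x) < e) ->
  cvg (f x @[x --> F]).
Proof.
move=> Fl; apply: cauchy_cvg; apply: cauchy_exP => e e0.
have e_real : of_real k (to_real e) = e by apply/to_realK/ltW.
have /Fl[l Hl] : 0 < to_real e.
  by rewrite -(ltr_of_real (k := k)) e_real rmorph0.
exists l; apply: filterS Hl => x.
by rewrite -ball_normE /ball_ /= -(ltr_of_real (k := k)) of_real_norm e_real.
Qed.

(** Rescaling a nonzero [v] to norm 1 places [T w] in the set under the [sup]; boundedness of [T]
    makes that [sup] an actual upper bound. *)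
Lemma ler_operator_norm {R : realType} {k : scalar_kind}
    {V : normedModType (scalars R k)} (T : V -> V) v :
  linear T -> bounded_operator T ->
  real_norm (T v) <= operator_norm T * real_norm v.
Proof.
move=> Tlin [M TM].
pose L : {linear V -> V} := HB.pack T (GRing.isLinear.Build _ _ _ _ T Tlin).
have T0 : T 0 = 0 := linear0 L.
have TZ c u : T (c *: u) = c *: T u := linearZ_LR L c u.
have [v0|v_neq0] := eqVneq (real_norm v) 0.
  by rewrite v0 mulr0 (real_norm0_eq0 _ v0) T0 real_norm0.
have v_gt0 : 0 < real_norm v by rewrite lt_def v_neq0 real_norm_ge0.
pose w := of_real k (real_norm v)^-1 *: v.
have normw : real_norm w = 1.
  by rewrite real_normZ ger0_norm ?invr_ge0 ?real_norm_ge0// mulVf.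
have -> : T v = of_real k (real_norm v) *: T w.
  by rewrite TZ scalerA -rmorphM/= mulfV// rmorph1 scale1r.
rewrite real_normZ ger0_norm ?real_norm_ge0// mulrC ler_pM2r//.
apply: sup_upper_bound; last first.
  by exists w => //=; rewrite -of_real_norm normw rmorph1.
split.
  by exists (real_norm (T w)), w => //=; rewrite -of_real_norm normw rmorph1.
(* [M] carries no sign assumption, hence the absolute value. *)
exists `|M| => _ [u /= u1 <-].
rewrite -(ler_of_real (k := k)) of_real_norm (le_trans (TM u))//.
rewrite -of_real_norm -rmorphM/= ler_of_real.
have {}u1 : real_norm u <= 1.
  by rewrite -(ler_of_real (k := k)) of_real_norm rmorph1.
rewrite (le_trans (ler_norm _))// normrM ler_piMr//.
by rewrite ger0_norm ?real_norm_ge0.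
Qed.

(** * Differentiability at 0 of a uniformly continuous one-parameter group *)

Section uniformly_continuous_group.
Context {R : realType} {k : scalar_kind}.
Context {V : completeNormedModType (scalars R k)}.
Variable alpha : R -> {linear V -> V}.
Hypothesis alphaD : forall t s v, alpha (t + s) v = alpha t (alpha s v).
Hypothesis alpha_near_id : forall e : R, 0 < e ->
  exists2 r : R, 0 < r &
    forall t v, `|t| <= r -> real_norm (alpha t v - v) <= e * real_norm v.

Definition difference_quotient (v : V) (t : R) : V :=
  of_real k t^-1 *: (alpha t v - v).

Local Notation q := difference_quotient.

Lemma scale_difference_quotient v t : t != 0 ->
  of_real k t *: q v t = alpha t v - v.
Proof. by move=> t0; rewrite scalerA -rmorphM/= mulfV// rmorph1 scale1r. Qed.

(** Applying [alpha (- t)] to [alpha t v - v] gives [v - alpha (- t) v], so [alpha (- t)] maps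
    [q v t] to [q v (- t)]. *)
Lemma difference_quotientN v t :
  alpha 0 v = v -> q v (- t) - q v t = alpha (- t) (q v t) - q v t.
Proof.
move=> alpha0; congr (_ - _).
rewrite /q linearZ/= (linearB (alpha (- t)))/= -alphaD addNr alpha0.
by rewrite invrN rmorphN/= scaleNr -scalerN opprB.
Qed.

(** With w = alpha_t v - v, the vector inside the norm telescopes to the sum over j < n of
    alpha_{jt} w - w, and each term has norm at most e |w|. The induction adds the term j = n. *)
Lemma difference_natmul_close (e tau t : R) n v :
  (forall s u, `|s| <= tau -> real_norm (alpha s u - u) <= e * real_norm u) ->
  0 <= t -> t * n%:R <= tau ->
  alpha 0 v = v ->
  real_norm (alpha (t * n%:R) v - v - (alpha t v - v) *+ n) <=
    n%:R * (e * real_norm (alpha t v - v)).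
Proof.
move=> close t0 + alpha0; elim: n => [|n IH] nt.
  by rewrite mulr0 mulr0n subr0 alpha0 subrr real_norm0 mul0r.
have nt' : t * n%:R <= tau by rewrite (le_trans _ nt)// ler_wpM2l// ler_nat.
set w := alpha t v - v.
have -> : alpha (t * n.+1%:R) v - v - w *+ n.+1 =
    (alpha (t * n%:R) v - v - w *+ n) + (alpha (t * n%:R) w - w).
  rewrite -[n.+1]addn1 natrD mulrDr mulr1 alphaD mulrnDr mulr1n.
  rewrite {3}/w linearB/= opprD !addrA; congr (_ - w).
  by rewrite -/w [RHS]addrC !addrA addNr add0r [RHS]addrC addrA.
rewrite (le_trans (ler_real_normD _ _))// -addn1 natrD mulrDl mul1r lerD ?IH//.
by apply: close; rewrite ger0_norm// mulr_ge0.
Qed.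

(** Write tau = nt + r with 0 <= r <= t. The last move by r costs [eta], the telescoping error costs
    [e], and the missing multiple r q_t costs t / tau. [eta] is separate from [e] because it gets
    divided by [tau], so it must be chosen after [tau]. *)
Lemma difference_quotient_close (e eta tau t : R) v :
  (forall s u, `|s| <= tau -> real_norm (alpha s u - u) <= e * real_norm u) ->
  (forall s u, `|s| <= t -> real_norm (alpha s u - u) <= eta * real_norm u) ->
  0 < t -> t <= tau -> 0 <= e -> 0 <= eta ->
  alpha 0 v = v ->
  real_norm (q v tau - q v t) <=
    (e + t / tau) * real_norm (q v t) + eta * (1 + e) / tau * real_norm v.
Proof.
move=> close_e close_eta t0 t_tau e0 eta0 alpha0.
have tau0 : 0 < tau := lt_le_trans t0 t_tau.
(* [n] is the integer part of tau / t, so [x] is the largest multiple of [t] not exceeding [tau]. *)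
have /andP[] := truncn_itv (ltW (divr_gt0 tau0 t0)).
set n := Num.truncn _; rewrite ler_pdivlMr// ltr_pdivrMr//.
rewrite -addn1 natrD mulrDl mul1r mulrC; set x := t * n%:R => x_tau tau_x.
have x0 : 0 <= x by rewrite mulr_ge0// ltW.
pose r := tau - x.
have r0 : 0 <= r by rewrite subr_ge0.
have rt : r <= t by rewrite lerBlDl ltW.
have E : of_real k tau *: (q v tau - q v t) =
    (alpha r (alpha x v) - alpha x v) +
    ((alpha x v - v - (alpha t v - v) *+ n) - of_real k r *: q v t).
  rewrite scalerBr scale_difference_quotient ?gt_eqF// -alphaD subrK.
  rewrite rmorphB/= scalerBl opprB.
  have -> : of_real k x *: q v t = (alpha t v - v) *+ n.
    rewrite -scale_difference_quotient ?gt_eqF// /x rmorphM/= rmorph_nat.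
    by rewrite mulrC -scalerA scaler_nat.
  by rewrite !addrA !subrK.
have N1 : real_norm (alpha r (alpha x v) - alpha x v) <=
    eta * ((1 + e) * real_norm v).
  rewrite (le_trans (close_eta _ _ _)) ?ger0_norm// ler_wpM2l//.
  rewrite -[alpha x v](subrK v) (le_trans (ler_real_normD _ _))//.
  by rewrite addrC mulrDl mul1r lerD2l close_e// ger0_norm.
have N2 := @difference_natmul_close e tau t n v close_e (ltW t0) x_tau alpha0.
have deltaN : real_norm (alpha t v - v) = t * real_norm (q v t).
  by rewrite -scale_difference_quotient ?gt_eqF// real_normZ gtr0_norm.
rewrite deltaN in N2.
have normE := real_normZ tau (q v tau - q v t).
rewrite gtr0_norm// E in normE.
have := real_norm_ge0 (q v t); set X := real_norm (q v t) => X0.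
have eX : e * X * x <= e * X * tau by rewrite ler_wpM2l// mulr_ge0.
have rX : r * X <= t * X by rewrite ler_wpM2r.
rewrite -(ler_pM2l tau0) -normE.
rewrite (le_trans (ler_real_normD _ _))//.
rewrite (le_trans (lerD N1 (ler_real_normD _ _)))//.
rewrite real_normN real_normZ ger0_norm//.
have -> : tau * ((e + t / tau) * X + eta * (1 + e) / tau * real_norm v) =
    eta * ((1 + e) * real_norm v) + (e * X * tau + t * X).
  by field; rewrite gt_eqF.
have N2E : n%:R * (e * (t * X)) = e * X * x by rewrite /x; ring.
by rewrite lerD2l lerD// (le_trans N2)// N2E.
Qed.

Hypothesis alpha0 : forall v, alpha 0 v = v.

(** With e = 1/4 and t / r <= 1/4 the coefficient of |q_t v| is at most 1/2; it is absorbed on the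
    left, which produces the factor 2 in the bound. *)
Lemma difference_quotient_bounded v :
  exists2 M : R, 0 <= M & exists2 r : R, 0 < r &
    forall t, 0 < t -> t <= r -> real_norm (q v t) <= M.
Proof.
have [|r r0 close] := alpha_near_id (4^-1); first by lra.
exists (2 * (real_norm (q v r) + 4^-1 * (1 + 4^-1) / r * real_norm v)).
  rewrite mulr_ge0// addr_ge0 ?real_norm_ge0//.
  by rewrite !mulr_ge0 ?real_norm_ge0 ?invr_ge0// ltW.
exists (r / 4) => [|t t0 tr]; first by lra.
have tr' : t <= r by lra.
have := @difference_quotient_close 4^-1 4^-1 r t v close.
move=> /(_ _ t0 tr' _ _ (alpha0 v)).
have : real_norm (q v t) <= real_norm (q v r) + real_norm (q v r - q v t).
  rewrite -{1}(subKr (q v r) (q v t)) (le_trans (ler_real_normD _ _))//.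
  by rewrite real_normN.
have : t / r <= 4^-1 by rewrite ler_pdivrMr//; lra.
set C := 4^-1 * _ / r * _; have := real_norm_ge0 (q v t).
set X := real_norm (q v t) => X0 trX H1 H2.
have {}trX : (4^-1 + t / r) * X <= 2^-1 * X by rewrite ler_wpM2r//; lra.
suff : real_norm (q v r - q v t) <= (4^-1 + t / r) * X + C by lra.
apply: H2; [|lra|lra].
by move=> s u sr; apply: close; lra.
Qed.

Lemma cvg_difference_quotient v : cvg (q v t @[t --> (0 : R)^']).
Proof.
apply: cvg_real_norm_cauchy => e e0.
have [M M0 [r r0 qM]] := difference_quotient_bounded v.
(* Error budget in units of e / 8: two for (e' + t / tau) M, one for the [eta] term, one more for
   negative times. [M + 1] keeps the denominator positive. *)
pose e' := e / (8 * (M + 1)).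
have e'0 : 0 < e' by rewrite divr_gt0// mulr_gt0//; lra.
have e'M : e' * M <= e / 8.
  rewrite /e' mulrAC ler_pdivrMr; last by lra.
  have -> : e / 8 * (8 * (M + 1)) = e * M + e by field.
  by lra.
have [tau tau0 close_tau] := alpha_near_id _ e'0.
pose eta := e * tau / (8 * (1 + e') * (real_norm v + 1)).
have nv0 := real_norm_ge0 v.
have eta0 : 0 < eta by rewrite !(divr_gt0, mulr_gt0)//; lra.
have [rho rho0 close_rho] := alpha_near_id _ eta0.
have etaN : eta * (1 + e') / tau * real_norm v <= e / 8.
  have -> : eta * (1 + e') / tau * real_norm v =
      e / 8 * (real_norm v / (real_norm v + 1)).
    by rewrite /eta; field; rewrite !gt_eqF//; lra.
  by rewrite ler_piMr ?ler_pdivrMr ?divr_ge0//; lra.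
exists (q v tau).
(* The four bounds give, in order, |q_t v| <= M, closeness [eta] up to time [t], t <= tau, and t /
   tau <= e'. *)
pose m := Num.min (Num.min r rho) (Num.min tau (tau * e')).
have m0 : 0 < m by rewrite !lt_min r0 rho0 tau0 mulr_gt0.
have pos t : 0 < t -> t < m ->
    real_norm (q v t) <= M /\ real_norm (q v tau - q v t) <= 3 * (e / 8).
  rewrite !lt_min => t0 /andP[/andP[tr trho] /andP[ttau ttau']].
  have qt := qM t t0 (ltW tr); split=> //.
  have /(_ _ t0 (ltW ttau) (ltW e'0) (ltW eta0) (alpha0 v)) :=
    @difference_quotient_close e' eta tau t v close_tau.
  move=> /(_ (fun s u st => close_rho s u (le_trans st (ltW trho)))).
  have te : t / tau <= e' by rewrite ler_pdivrMr// mulrC ltW.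
  have : (e' + t / tau) * real_norm (q v t) <= (e' + e') * M.
    apply: ler_pM (real_norm_ge0 _) _ qt; last by rewrite lerD2l.
    by rewrite ltW// addr_gt0// divr_gt0.
  lra.
near=> t.
have tm : `|t| < m.
  by near: t; exact: dnbhs0_lt.
have t_neq0 : t != 0 by near: t; exact: nbhs_dnbhs_neq.
have [qM' qtau] := pos `|t| (ltac:(by rewrite normr_gt0)) tm.
have [t0|t0] := ltP 0 t.
  by rewrite (gtr0_norm t0) in qtau; lra.
rewrite (ler0_norm t0) in tm qM' qtau.
(* Here - t = |t| is a time covered by [pos], and [alpha t] carries [q v (- t)] to [q v t] at cost
   at most e' M. *)
have qN : real_norm (q v (- t) - q v t) <= e / 8.
  rewrite -real_normN opprB -[t in q v t]opprK difference_quotientN//.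
  rewrite opprK (le_trans (close_tau _ _ _))//.
    by rewrite ler0_norm// ltW// (lt_le_trans tm)// /m !ge_min lexx !orbT.
  by rewrite (le_trans _ e'M)// ler_wpM2l// ltW.
rewrite -(subrK (q v (- t)) (q v tau)) -addrA.
rewrite (le_lt_trans (ler_real_normD _ _))//; lra.
Unshelve. all: by end_near.
Qed.

End uniformly_continuous_group.

(** * Bilinearity and joint continuity of the product *)

Section banach_algebra.
Context {K : numFieldType} {A : banachAlgType K}.
Implicit Types a b c : A.

Lemma bmulDl a b c : (a + b) ⋅ c = a ⋅ c + b ⋅ c.
Proof. by have := bmul_linear_l c 1 a b; rewrite !scale1r. Qed.

Lemma bmulDr a b c : a ⋅ (b + c) = a ⋅ b + a ⋅ c.
Proof. by have := bmul_linear_r a 1 b c; rewrite !scale1r. Qed.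

Lemma bmul0l c : 0 ⋅ c = 0.
Proof. by apply: (addrI (0 ⋅ c)); rewrite -bmulDl !addr0. Qed.

Lemma bmul0r a : a ⋅ 0 = 0.
Proof. by apply: (addrI (a ⋅ 0)); rewrite -bmulDr !addr0. Qed.

Lemma bmulZl (x : K) a c : (x *: a) ⋅ c = x *: (a ⋅ c).
Proof. by have := bmul_linear_l c x a 0; rewrite !addr0 bmul0l addr0. Qed.

Lemma bmulZr (x : K) a c : a ⋅ (x *: c) = x *: (a ⋅ c).
Proof. by have := bmul_linear_r a x c 0; rewrite !addr0 bmul0r addr0. Qed.

Lemma bmulNl a c : (- a) ⋅ c = - (a ⋅ c).
Proof. by rewrite -scaleN1r bmulZl scaleN1r. Qed.

Lemma bmulNr a c : a ⋅ (- c) = - (a ⋅ c).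
Proof. by rewrite -scaleN1r bmulZr scaleN1r. Qed.

Context {T : Type} {F : set_system T} {FF : Filter F}.

Lemma cvg_bmul0 (f g : T -> A) :
  `|f x| * `|g x| @[x --> F] --> (0 : K) -> f x ⋅ g x @[x --> F] --> 0.
Proof.
move=> /cvgr0Pnorm_le fg0; apply/cvgr0Pnorm_le => e /fg0.
apply: filterS => x; apply: le_trans.
by rewrite ger0_norm ?mulr_ge0// ler_norm_bmul.
Qed.

Lemma cvg_bmul (f g : T -> A) a b :
  f x @[x --> F] --> a -> g x @[x --> F] --> b ->
  f x ⋅ g x @[x --> F] --> a ⋅ b.
Proof.
move=> fa gb; apply/subr_cvg0.
have E : (fun x => f x ⋅ g x - a ⋅ b) =
    (fun x => (f x - a) ⋅ g x + a ⋅ (g x - b)).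
  apply/funext => x; rewrite bmulDl bmulDr bmulNl bmulNr.
  by rewrite addrA subrK.
rewrite E -[0]addr0; apply: cvgD; apply: cvg_bmul0.
- rewrite -(mul0r `|b|) -(@normr0 _ A); apply: cvgM; apply: cvg_norm => //.
  exact/subr_cvg0.
- rewrite -(mulr0 `|a|) -(@normr0 _ A); apply: cvgM; apply: cvg_norm => //.
    exact: cvg_cst.
  exact/subr_cvg0.
Qed.

End banach_algebra.

(** With D = alpha - id, [beta] is D + sigma. Expanding [beta a ⋅ beta b], the terms [sigma (a ⋅ b)]
    and [sigma a ⋅ sigma b] cancel from both sides. *)
Lemma sigma_endomorphism_subid (K : numFieldType) (A : banachAlgType K)
    (sigma alpha : A -> A) a b :
  sigma_endomorphism sigma alpha ->
  alpha (a ⋅ b) - a ⋅ b =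
    (alpha a - a) ⋅ (alpha b - b) + (alpha a - a) ⋅ sigma b +
    sigma a ⋅ (alpha b - b).
Proof.
move=> [_ /(_ a b)] /= /(canRL (subrK _)).
rewrite ![_ + sigma _ - _]addrAC -[RHS]addrA [RHS]addrC => /addIr ->.
set da := alpha a - a; set db := alpha b - b.
by rewrite bmulDl !bmulDr addrC !addrA addrK.
Qed.

(** * From the sigma-dynamics to its sigma-derivation *)

Theorem proposition2p9 (R : realType) (k : scalar_kind)
    (A : banachAlgType (scalars R k)) (sigma : {linear A -> A})
    (alpha : R -> A -> A) :
  sigma_dynamics sigma alpha ->
  let q (a : A) (t : R) : A := of_real k t^-1 *: (alpha t a - a) in
  (forall a : A, cvg (q a t @[t --> (0 : R)^'])) /\
  sigma_derivation sigma (fun a : A => lim (q a t @[t --> (0 : R)^'])).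
Proof.
move=> [alphaP alphaD alpha0 alpha_cvg] q.
have [L LE] : exists L : R -> {linear A -> A}, forall t a, L t a = alpha t a.
  pose L t : {linear A -> A} :=
    HB.pack (alpha t) (GRing.isLinear.Build _ _ _ _ (alpha t) (alphaP t).1.1).
  by exists L.
have LD t s a : L (t + s) a = L t (L s a) by rewrite !LE -alphaD.
have L0 a : L 0 a = a by rewrite LE alpha0.
have L_near_id (e : R) : 0 < e -> exists2 r : R, 0 < r &
    forall t a, `|t| <= r -> real_norm (L t a - a) <= e * real_norm a.
  move=> e0.
  have /cvgrPdist_le/(_ e e0) := alpha_cvg.
  move=> /nbhs_ballP[r /= r0 close].
  (* Halving passes from an open ball to a closed interval. The limit is along punctured
     neighbourhoods, so t = 0 is treated apart. *)
  exists (r / 2) => [|t a tr]; first by rewrite divr_gt0.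
  have [->|t0] := eqVneq t 0.
    by rewrite L0 subrr real_norm0 mulr_ge0 ?real_norm_ge0// ltW.
  have tlin : linear (fun a => alpha t a - a).
    move=> x u v; rewrite -!LE (linearP (L t))/=.
    by rewrite scalerBr opprD addrACA.
  have tbnd : bounded_operator (fun a => alpha t a - a).
    have [_ [M HM]] := alphaP t; exists (M + 1) => u.
    rewrite rmorphD rmorph1 mulrDl mul1r (le_trans (ler_normB _ _))//.
    by rewrite lerD2r.
  rewrite LE; apply: le_trans (ler_operator_norm _ a tlin tbnd) _.
  rewrite ler_wpM2r ?real_norm_ge0//.
  have : `|0 - operator_norm (fun a => alpha t a - a)| <= e.
    apply: close => //=.
    rewrite -ball_normE /ball_ /= sub0r normrN (le_lt_trans tr)//.
    by rewrite ltr_pdivrMr//; lra.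
  by rewrite sub0r normrN; exact: le_trans (ler_norm _).
have q_cvg a : cvg (q a t @[t --> (0 : R)^']).
  have -> : q a = difference_quotient L a.
    by apply/funext => t; rewrite /difference_quotient LE.
  exact: (@cvg_difference_quotient _ _ _ L LD L_near_id L0).
split=> //; split=> [x a b|a b].
  apply/cvg_lim => //.
  have -> : q (x *: a + b) = (fun t => x *: q a t + q b t).
    apply/funext => t; rewrite /q -!LE (linearP (L t))/= opprD addrACA -scalerBr.
    by rewrite scalerDr !scalerA mulrC.
  by apply: cvgD; [apply: cvgZl_tmp|]; exact: q_cvg.
apply/cvg_lim => //.
have delta_cvg : alpha t b - b @[t --> (0 : R)^'] --> (0 : A).
  apply: cvg_real_norm_dist => e e0.
  have nb := real_norm_ge0 b.
  have /L_near_id[r r0 close] : 0 < e / (real_norm b + 1).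
    by rewrite divr_gt0//; lra.
  near=> t; rewrite subr0 -LE (le_trans (close t b _))//.
    by near: t; exact: dnbhs0_le.
  by rewrite mulrAC ler_pdivrMr ?ler_wpM2l//; lra.
(* In D(a) D(b) the factor 1/t is given to D(a) alone; the other factor then tends to 0 by
   [delta_cvg]. *)
have -> : q (a ⋅ b) = (fun t => q a t ⋅ (alpha t b - b) + q a t ⋅ sigma b +
    sigma a ⋅ q b t).
  apply/funext => t.
  rewrite /q (sigma_endomorphism_subid _ _ _ _ a b (alphaP t).1).
  by rewrite !bmulZl bmulZr -!scalerDr.
(* The limit is padded with d(a) ⋅ 0, the limit of the quadratic term, to match the three
   summands. *)
rewrite -[X in _ --> X + _]add0r.
rewrite -[X in _ --> X + _ + _](bmul0r (lim (q a t @[t --> (0 : R)^']))).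
apply: cvgD; [apply: cvgD|]; apply: cvg_bmul => //;
  try exact: q_cvg; exact: cvg_cst.
Unshelve. all: by end_near.
Qed.
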